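(* Let $A\in\mathbb{R}^{n\times n}$ and suppose that, for every $j\in\{1,\dots,q\}$, $\Lambda_j$ is simple real or simple complex. Let $j\in\{2,\dots,q\}$, $t\in\mathbb{R}$, and $u\in\mathbb{R}^n$ with $\widehat w^{(1)}u\neq0$. Put $G_j(t,u):=g_j(t,u)/g_1(t,u)$ and $G_j(t):=g_j(t)/g_1(t)$. (1) If both $\Lambda_j$ and $\Lambda_1$ are simple real, then $G_j(t,u)=1$ and $G_j(t)=1$. (2) If $\Lambda_j$ is simple complex and $\Lambda_1$ is simple real, then $G_j(t,u)=2\|\widehat\Theta_j(t,u)\|$ and $G_j(t)=2\|\widehat\Theta_j(t)\|$. In particular, when the vector norm is a $p$-norm, $G_j(t,u)\le2$ and $G_j(t)\le2$. (3) If $\Lambda_j$ is simple real and $\Lambda_1$ is simple complex, then $$G_j(t,u)=\frac{1}{2\|\widehat\Theta_1(t,u)\|}\quad\text{and}\quad G_j(t)=\frac{1}{2\|\widehat\Theta_1(t)\|}.$$ In particular, when the vector norm is the Euclidean norm, $$G_j(t,u)\le\sqrt{\frac{1}{2(1-V_1)}}\quad\text{and}\quad G_j(t)\le\sqrt{\frac{1}{a_{V_1W_1}}},$$ where $a_{V_1W_1}=(1-V_1)(1+W_1)$ if $V_1\le W_1$ and $a_{V_1W_1}=(1+V_1)(1-W_1)$ if $V_1\ge W_1$. (4) If both $\Lambda_j$ and $\Lambda_1$ are simple complex, then $$G_j(t,u)=\frac{\|\widehat\Theta_j(t,u)\|}{\|\widehat\Theta_1(t,u)\|}\quad\text{and}\quad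 G_j(t)=\frac{\|\widehat\Theta_j(t)\|}{\|\widehat\Theta_1(t)\|}.$$ In particular, when the vector norm is the Euclidean norm, $$G_j(t,u)\le\sqrt{\frac{1+V_j}{1-V_1}}\quad\text{and}\quad G_j(t)\le\sqrt{\frac{(1+V_j)(1+W_j)}{a_{V_1W_1}}}.$$
   Context: $\|\cdot\|$ is an arbitrary norm on $\mathbb{C}^n$ (also used on $\mathbb{R}^n$). For $B\in\mathbb{R}^{n\times n}$, $\|B\|:=\max_{u\in\mathbb{R}^n,\|u\|=1}\|Bu\|$. For a real row vector $b$, $\|b\|:=\max_{u\in\mathbb{R}^n,\|u\|=1}|bu|$; for a complex row vector $b$, $\|b\|:=\max_{u\in\mathbb{C}^n,\|u\|=1}|bu|$. The spectrum of $A$ is partitioned by real parts into $\Lambda_1,\dots,\Lambda_q$, where $\Lambda_j$ contains all eigenvalues with real part $r_j$ and $r_1>\dots>r_q$. $\Lambda_j$ is simple real if it consists of one simple real eigenvalue $\lambda_j$; it is simple complex if it consists of a complex conjugate pair $\lambda_j,\overline{\lambda_j}$ of simple non-real eigenvalues, where $\lambda_j$ has positive imaginary part $\omega_j>0$. Let $V$ be an invertible matrix whose columns are eigenvectors of $A$ and $W=V^{-1}$; $v^{(j)}$ is the column of $V$ that is an eigenvector for $\lambda_j$ and $w^{(j)}$ is the row of $W$ with the same index. The columns are chosen so that $v^{(j)},w^{(j)}$ are real if $\Lambda_j$ is simple real, and, if $\Lambda_j$ is simple complex, the column of $V$ for $\overline{\lambda_j}$ is $\overline{v^{(j)}}$ and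 the corresponding row of $W$ is $\overline{w^{(j)}}$. Put $\widehat v^{(j)}:=v^{(j)}/\|v^{(j)}\|$, $\widehat w^{(j)}:=w^{(j)}/\|w^{(j)}\|$, $f_j:=\|w^{(j)}\|\|v^{(j)}\|$, where $\|w^{(j)}\|$ is the real induced norm in the simple real case and the complex induced norm in the simple complex case. Define $Q_j(t)=v^{(j)}w^{(j)}$ if $\Lambda_j$ is simple real and $Q_j(t)=2\,\mathrm{Re}(\mathrm{e}^{\mathrm{i}\omega_jt}v^{(j)}w^{(j)})$ if $\Lambda_j$ is simple complex. For $\Lambda_j$ simple complex write $\widehat v^{(j)}_k=|\widehat v^{(j)}_k|\mathrm{e}^{\mathrm{i}\alpha_{jk}}$, $\widehat w^{(j)}_l=|\widehat w^{(j)}_l|\mathrm{e}^{\mathrm{i}\beta_{jl}}$, $\widehat w^{(j)}u=|\widehat w^{(j)}u|\mathrm{e}^{\mathrm{i}\gamma_j(u)}$ (polar forms; the angle of $0$ is any fixed real number) and $$\widehat\Theta_j(t,u):=\big(|\widehat v^{(j)}_k|\cos(\omega_jt+\alpha_{jk}+\gamma_j(u))\big)_{k}\in\mathbb{R}^n,\quad \widehat\Theta_j(t):=\big[|\widehat v^{(j)}_k||\widehat w^{(j)}_l|\cos(\omega_jt+\alpha_{jk}+\beta_{jl})\big]_{k,l}\in\mathbb{R}^{n\times n}.$$ The numbers $g_j(t,u)$, $g_j(t)$ are such that $\|Q_j(t)u\|=f_j|\widehat w^{(j)}u|\,g_j(t,u)$ and $\|Q_j(t)\|=f_jg_j(t)$;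 when $\widehat w^{(j)}u=0$ (so that the first relation does not determine $g_j(t,u)$) one sets $g_j(t,u)=1$ if $\Lambda_j$ is simple real and $g_j(t,u)=2\|\widehat\Theta_j(t,u)\|$ if $\Lambda_j$ is simple complex. When the norm is Euclidean and $\Lambda_j$ is simple complex, $V_j:=|(\widehat v^{(j)})^T\widehat v^{(j)}|$ and $W_j:=|\widehat w^{(j)}(\widehat w^{(j)})^T|$ (transposes without conjugation); $V_j,W_j\in[0,1)$. *)

(* Defs.v *)
From HB Require Import structures.
From mathcomp Require Import all_boot all_order all_algebra.
From mathcomp Require Import all_classical all_reals all_analysis.
From mathcomp Require Import complex.

Set Implicit Arguments.
Unset Strict Implicit.
Unset Printing Implicit Defensive.

Import Order.TTheory GRing.Theory Num.Theory.
Import numFieldNormedType.Exports.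

Local Open Scope classical_set_scope.
Local Open Scope complex_scope.
Local Open Scope ring_scope.

Notation toC := (map_mx (real_complex _)).
Notation conj_mx := (map_mx Num.conj).
Notation modulus := ComplexField.Normc.normc.

Definition cis (R : realType) (x : R) : R[i] := cos x +i* sin x.

(* Any real is accepted as an angle of 0. *)
Definition is_angle (R : realType) (z : R[i]) (a : R) : Prop :=
  z = (modulus z)%:C * cis a.

Definition re_mx (R : realType) m n (B : 'M[R[i]]_(m, n)) : 'M[R]_(m, n) :=
  map_mx (@complex.Re R) B.

Record is_norm (R : realType) n (N : 'cV[R[i]]_n -> R) : Prop := IsNorm {
  norm_definite : forall x, N x = 0 -> x = 0;
  norm_homogeneous : forall (c : R[i]) x, N (c *: x) = modulus c * N x;
  norm_triangle : forall x y, N (x + y) <= N x + N y }.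

(* The suprema below are over continuous images of unit spheres: for 0 < n they
   are maxima. *)
Definition opnorm (R : realType) n (N : 'cV[R[i]]_n -> R) (B : 'M[R]_n) : R :=
  sup [set N (toC (B *m u)) | u in [set u : 'cV[R]_n | N (toC u) = 1]].

Definition rownormR (R : realType) n (N : 'cV[R[i]]_n -> R)
    (b : 'rV[R[i]]_n) : R :=
  sup [set modulus ((b *m toC u) 0 0)
      | u in [set u : 'cV[R]_n | N (toC u) = 1]].

Definition rownormC (R : realType) n (N : 'cV[R[i]]_n -> R)
    (b : 'rV[R[i]]_n) : R :=
  sup [set modulus ((b *m u) 0 0) | u in [set u : 'cV[R[i]]_n | N u = 1]].

Definition pnorm (R : realType) n (p : \bar R) (x : 'cV[R[i]]_n) : R :=
  match p with
  | r%:E => (\sum_k modulus (x k 0) `^ r) `^ r^-1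
  | +oo%E => \big[Num.max/0]_k modulus (x k 0)
  | -oo%E => 0
  end.

Definition euclidean_norm (R : realType) n (x : 'cV[R[i]]_n) : R :=
  Num.sqrt (\sum_k modulus (x k 0) ^+ 2).

(* q classes are indexed by the ordinals below q, the class with the largest
   real part having index 0. *)
Definition real_parts (R : realType) n q (A : 'M[R]_n) (r : 'I_q -> R) : Prop :=
  (forall i k : 'I_q, (i < k)%N -> r k < r i) /\
  (forall x : R, (exists j, r j = x) <->
     (exists z : R[i], eigenvalue (toC A) z /\ complex.Re z = x)).

Definition Lambda (R : realType) n (A : 'M[R]_n) (x : R) : set R[i] :=
  [set z | eigenvalue (toC A) z /\ complex.Re z = x].

Definition simple_eigenvalue (R : realType) n (A : 'M[R]_n) (z : R[i]) : Prop :=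
  mup z (char_poly (toC A)) = 1%N.

Definition simple_real (R : realType) n (A : 'M[R]_n) (x : R) (lam : R[i]) :
    Prop :=
  [/\ Lambda A x = [set lam], lam \is Num.real & simple_eigenvalue A lam].

Definition simple_complex (R : realType) n (A : 'M[R]_n) (x : R) (lam : R[i]) :
    Prop :=
  [/\ Lambda A x = [set lam; Num.conj lam], 0 < complex.Im lam,
      simple_eigenvalue A lam & simple_eigenvalue A (Num.conj lam)].

Definition is_eigenvector (R : realType) n (A : 'M[R]_n) (z : R[i])
    (v : 'cV[R[i]]_n) : Prop :=
  v != 0 /\ toC A *m v = z *: v.

(* An eigenvalue with its column of V and the corresponding row of V^-1. *)
Record mode (R : realType) (n : nat) := Mode {
  lam : R[i];
  vec : 'cV[R[i]]_n;
  row_vec : 'rV[R[i]]_n }.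

Definition is_mode_of (R : realType) n (A : 'M[R]_n) (V : 'M[R[i]]_n)
    (m : mode R n) : Prop :=
  exists k, [/\ vec m = col k V, row_vec m = row k (invmx V)
              & is_eigenvector A (lam m) (col k V)].

Definition omega (R : realType) n (m : mode R n) : R := complex.Im (lam m).

(* In the definitions below, reality of the eigenvalue distinguishes the simple
   real from the simple complex classes. *)
Definition row_vec_norm (R : realType) n (N : 'cV[R[i]]_n -> R)
    (m : mode R n) : R :=
  if lam m \is Num.real then rownormR N (row_vec m) else rownormC N (row_vec m).

Definition vhat (R : realType) n (N : 'cV[R[i]]_n -> R) (m : mode R n) :
    'cV[R[i]]_n :=
  ((N (vec m))^-1)%:C *: vec m.

Definition what (R : realType) n (N : 'cV[R[i]]_n -> R) (m : mode R n) :
    'rV[R[i]]_n :=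
  ((row_vec_norm N m)^-1)%:C *: row_vec m.

Definition what_app (R : realType) n (N : 'cV[R[i]]_n -> R) (m : mode R n)
    (u : 'cV[R]_n) : R[i] :=
  (what N m *m toC u) 0 0.

Definition f_ (R : realType) n (N : 'cV[R[i]]_n -> R) (m : mode R n) : R :=
  row_vec_norm N m * N (vec m).

(* In the simple real case the product vec m *m row_vec m has real entries and
   re_mx only changes its type. *)
Definition Q_ (R : realType) n (m : mode R n) (t : R) : 'M[R]_n :=
  if lam m \is Num.real then re_mx (vec m *m row_vec m)
  else 2 *: re_mx (cis (omega m * t) *: (vec m *m row_vec m)).

Definition Theta_vec (R : realType) n (N : 'cV[R[i]]_n -> R) (m : mode R n)
    (alpha : 'I_n -> R) (gamma : 'cV[R]_n -> R) (t : R) (u : 'cV[R]_n) :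
    'cV[R]_n :=
  \col_k (modulus (vhat N m k 0) * cos (omega m * t + alpha k + gamma u)).

Definition Theta_mx (R : realType) n (N : 'cV[R[i]]_n -> R) (m : mode R n)
    (alpha beta : 'I_n -> R) (t : R) : 'M[R]_n :=
  \matrix_(k, l) (modulus (vhat N m k 0) * modulus (what N m 0 l) *
                  cos (omega m * t + alpha k + beta l)).

Definition V_ (R : realType) n (N : 'cV[R[i]]_n -> R) (m : mode R n) : R :=
  modulus (((vhat N m)^T *m vhat N m) 0 0).

Definition W_ (R : realType) n (N : 'cV[R[i]]_n -> R) (m : mode R n) : R :=
  modulus ((what N m *m (what N m)^T) 0 0).

Definition a_ (R : realType) (x y : R) : R :=
  if x <= y then (1 - x) * (1 + y) else (1 + x) * (1 - y).

(* Main.v *)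
(* In the real case [Q_ u = v (w u)] has norm [f |what u|], and in the complex case
   [Q_ u = 2 f |what u| Theta_vec] and [Q_ = 2 f Theta_mx]; since [f > 0], this
   determines [g], and the formulas for the ratios follow.  Positivity of [f] needs
   linear forms to be bounded for an arbitrary norm, hence equivalence of norms.

   For the Euclidean estimates, [Theta_vec] is [Re (c vhat)] with [|c| = 1], and
   [|Re (c z)|^2 = (|z|^2 + Re (c^2 z.z)) / 2] for the bilinear product [z.z], so
   [|Theta_vec|^2] lies between [(1 - V_) / 2] and [(1 + V_) / 2].  As [Theta_mx] is
   [Re (c vhat what)], the same identity for [what] controls [|what u|] for real
   unit vectors [u], and hence the operator norm.  Finally [V_ < 1], because
   [V_ = 1] would make a unit multiple of [vhat] real. *)

Require Import Defs.
From HB Require Import structures.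
From mathcomp Require Import all_boot all_order all_algebra.
From mathcomp Require Import all_classical all_reals all_analysis.
From mathcomp Require Import complex.
From mathcomp Require Import ring lra.

Set Implicit Arguments.
Unset Strict Implicit.
Unset Printing Implicit Defensive.

Import Order.TTheory GRing.Theory Num.Theory.
Import numFieldNormedType.Exports.

Local Open Scope complex_scope.
Local Open Scope ring_scope.

(** * Moduli and phases *)

Section ComplexModulus.
Variable R : realType.
Implicit Types (z w c : R[i]) (x y : R).

Lemma modulus_ge0 z : 0 <= modulus z.
Proof. by case: z => a b; exact: sqrtr_ge0. Qed.

Lemma sqr_modulus z : modulus z ^+ 2 = complex.Re z ^+ 2 + complex.Im z ^+ 2.
Proof. by case: z => a b /=; rewrite sqr_sqrtr// addr_ge0// sqr_ge0. Qed.

Lemma modulusM z w : modulus (z * w) = modulus z * modulus w.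
Proof. exact: ComplexField.Normc.normcM. Qed.

Lemma modulus_real x : modulus x%:C = `|x|.
Proof. by rewrite /= expr0n addr0 sqrtr_sqr. Qed.

Lemma modulus0 : modulus (0 : R[i]) = 0.
Proof. by rewrite (modulus_real 0) normr0. Qed.

Lemma modulus_eq0 z : (modulus z == 0) = (z == 0).
Proof.
by apply/eqP/eqP => [/ComplexField.Normc.eq0_normc//|->]; exact: modulus0.
Qed.

Lemma modulus_gt0 z : (0 < modulus z) = (z != 0).
Proof. by rewrite lt_neqAle modulus_ge0 andbT eq_sym modulus_eq0. Qed.

Lemma Re_le_modulus z : `|complex.Re z| <= modulus z.
Proof.
rewrite -(@ler_pXn2r _ 2)// ?nnegrE ?modulus_ge0//.
by rewrite real_normK ?num_real// sqr_modulus lerDl sqr_ge0.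
Qed.

Lemma modulus_cis x : modulus (cis x) = 1.
Proof. by rewrite /= cos2Dsin2 sqrtr1. Qed.

Lemma cisD x y : cis (x + y) = cis x * cis y.
Proof. by rewrite /cis sinD cosD; simpc; rewrite [X in _ +i* X]addrC. Qed.

Lemma conjcM_modulus z : conjc z * z = (modulus z ^+ 2)%:C.
Proof.
rewrite sqr_modulus; case: z => a b; apply/eqP; rewrite eq_complex /=.
by apply/andP; split; apply/eqP; ring.
Qed.

Lemma modulus_conjc z : modulus (conjc z) = modulus z.
Proof. by case: z => a b /=; rewrite sqrrN. Qed.

Lemma Re_realM x z : complex.Re (x%:C * z) = x * complex.Re z.
Proof. by case: z => a b; rewrite /= mul0r subr0. Qed.

Lemma Im_realM x z : complex.Im (x%:C * z) = x * complex.Im z.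
Proof. by case: z => a b; rewrite /= mul0r addr0. Qed.

Lemma Re_Mreal x z : complex.Re (z * x%:C) = complex.Re z * x.
Proof. by rewrite mulrC Re_realM mulrC. Qed.

Lemma exists_phase z : exists2 c, modulus c = 1 & c * z = (modulus z)%:C.
Proof.
have [->|z0] := eqVneq z 0.
  by exists 1; rewrite ?mulr0 ?modulus0// (modulus_real 1) normr1.
have m0 : modulus z != 0 by rewrite modulus_eq0.
exists ((modulus z)^-1%:C * conjc z).
  rewrite modulusM modulus_real modulus_conjc normfV.
  by rewrite ger0_norm ?modulus_ge0// mulVf.
by rewrite -mulrA conjcM_modulus -rmorphM /= expr2 mulKf.
Qed.

Lemma polar_decomposition z : exists2 c, modulus c = 1 & z = (modulus z)%:C * c.
Proof.
have [c c1 cz] := exists_phase z; exists (conjc c); first by rewrite modulus_conjc.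
by rewrite -cz mulrC mulrA conjcM_modulus c1 expr1n mul1r.
Qed.

(** Meant for [z = \sum_i z_i ^+ 2]: replacing each [z_i] by [c * z_i] multiplies that sum by
    [c ^+ 2], so a square root of the phase makes it real and nonnegative. This is the extremal case
    of the identities for squared real and imaginary parts below. *)
Lemma exists_half_phase z :
  exists2 c, modulus c = 1 & c ^+ 2 * z = (modulus z)%:C.
Proof.
have [c c1 cz] := exists_phase z; exists (sqrtc c); last by rewrite sqr_sqrtc.
apply/eqP; rewrite -(@eqrXn2 _ 2)// ?modulus_ge0//.
by rewrite expr2 -modulusM -expr2 sqr_sqrtc c1 expr1n.
Qed.

End ComplexModulus.

(** * Cauchy-Schwarz and sums of squared real parts *)

Section QuadraticSums.
Variables (R : realType) (I : finType).
Implicit Types (a b : I -> R) (z : I -> R[i]) (c : R[i]).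

(** Expanding the nonnegative sum of [(B * a i - A * b i) ^+ 2] gives [2 * (A * B)] times the
    difference of the two sides. The factor can be cancelled unless [A] or [B] is 0, and then one of
    the families vanishes. *)
Lemma Cauchy_Schwarz_sum a b :
  \sum_i a i * b i <= Num.sqrt (\sum_i a i ^+ 2) * Num.sqrt (\sum_i b i ^+ 2).
Proof.
set A := Num.sqrt _; set B := Num.sqrt _.
have a20 : 0 <= \sum_i a i ^+ 2 by apply: sumr_ge0 => i _; exact: sqr_ge0.
have b20 : 0 <= \sum_i b i ^+ 2 by apply: sumr_ge0 => i _; exact: sqr_ge0.
have A2 : A ^+ 2 = \sum_i a i ^+ 2 by rewrite sqr_sqrtr.
have B2 : B ^+ 2 = \sum_i b i ^+ 2 by rewrite sqr_sqrtr.
have A0 : 0 <= A := sqrtr_ge0 _.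
have B0 : 0 <= B := sqrtr_ge0 _.
have null (d : I -> R) : \sum_i d i ^+ 2 = 0 -> forall i : I, d i = 0.
  move=> d0 i; apply/eqP; rewrite -sqrf_eq0; apply/eqP.
  by apply: psumr_eq0P d0 i isT => k _; exact: sqr_ge0.
have [Az|An] := eqVneq A 0.
  rewrite Az mul0r big1// => i _.
  by rewrite (null a) ?mul0r// -A2 Az expr0n.
have [Bz|Bn] := eqVneq B 0.
  rewrite Bz mulr0 big1// => i _.
  by rewrite (null b) ?mulr0// -B2 Bz expr0n.
have AB : 0 < A * B by rewrite mulr_gt0// lt_neqAle eq_sym ?An ?Bn.
have : 0 <= \sum_i (B * a i - A * b i) ^+ 2.
  by apply: sumr_ge0 => i _; exact: sqr_ge0.
have -> : \sum_i (B * a i - A * b i) ^+ 2 =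
    2 * (A * B) * (A * B - \sum_i a i * b i).
  under eq_bigr => i _.
    rewrite (_ : _ ^+ 2 = B ^+ 2 * a i ^+ 2 + (A ^+ 2 * b i ^+ 2
      - 2 * (A * B) * (a i * b i))); last by ring.
    over.
  rewrite big_split sumrB -!mulr_sumr -A2 -B2 /=; ring.
by rewrite pmulr_rge0 ?subr_ge0// mulr_gt0.
Qed.

(* [(Re s)^2 = (|s|^2 + Re (s^2)) / 2], summed over [s = c z_i]. *)
Lemma sum_sqr_Re z c : modulus c = 1 ->
  \sum_i complex.Re (c * z i) ^+ 2 =
  (\sum_i modulus (z i) ^+ 2 + complex.Re (c ^+ 2 * \sum_i z i ^+ 2)) / 2.
Proof.
move=> c1; rewrite mulr_sumr raddf_sum /= -big_split mulr_suml /=.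
apply: eq_bigr => i _.
have -> : modulus (z i) = modulus (c * z i) by rewrite modulusM c1 mul1r.
rewrite -exprMn sqr_modulus.
by case: (c * z i) => x y /=; field.
Qed.

Lemma sum_sqr_Im z c : modulus c = 1 ->
  \sum_i complex.Im (c * z i) ^+ 2 =
  (\sum_i modulus (z i) ^+ 2 - complex.Re (c ^+ 2 * \sum_i z i ^+ 2)) / 2.
Proof.
move=> c1; rewrite mulr_sumr raddf_sum /= -sumrB mulr_suml /=.
apply: eq_bigr => i _.
have -> : modulus (z i) = modulus (c * z i) by rewrite modulusM c1 mul1r.
rewrite -exprMn sqr_modulus.
by case: (c * z i) => x y /=; field.
Qed.

Lemma sum_sqr_Re_le z c : modulus c = 1 ->
  \sum_i complex.Re (c * z i) ^+ 2 <=
  (\sum_i modulus (z i) ^+ 2 + modulus (\sum_i z i ^+ 2)) / 2.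
Proof.
move=> c1; rewrite sum_sqr_Re// ler_pM2r ?invr_gt0// lerD2l.
rewrite (le_trans (ler_norm _))// (le_trans (Re_le_modulus _))//.
by rewrite expr2 !modulusM c1 !mul1r.
Qed.

Lemma sum_sqr_Re_ge z c : modulus c = 1 ->
  (\sum_i modulus (z i) ^+ 2 - modulus (\sum_i z i ^+ 2)) / 2 <=
  \sum_i complex.Re (c * z i) ^+ 2.
Proof.
move=> c1; rewrite sum_sqr_Re// ler_pM2r ?invr_gt0// lerD2l.
rewrite lerNl (le_trans (ler_norm _))// normrN (le_trans (Re_le_modulus _))//.
by rewrite expr2 !modulusM c1 !mul1r.
Qed.

End QuadraticSums.

(** * Norms on complex column vectors *)

Section Norms.
Variables (R : realType) (n : nat) (N : 'cV[R[i]]_n -> R).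
Hypothesis hN : is_norm N.

Let NZ c x : N (c *: x) = modulus c * N x := norm_homogeneous hN c x.
Let ND x y : N (x + y) <= N x + N y := norm_triangle hN x y.

Lemma norm_real x y : N (x%:C *: y) = `|x| * N y.
Proof. by rewrite NZ modulus_real. Qed.

Lemma norm_zero : N 0 = 0.
Proof. by rewrite -(scale0r 0) NZ modulus0 mul0r. Qed.

Lemma norm_opp x : N (- x) = N x.
Proof.
by rewrite -scaleN1r NZ -(rmorphN1 (real_complex R)) modulus_real normrN1 mul1r.
Qed.

Lemma norm_nonneg x : 0 <= N x.
Proof.
have := ND x (- x); rewrite subrr norm_zero norm_opp -mulr2n.
by rewrite pmulrn_lge0.
Qed.

Lemma norm_eq0 x : (N x == 0) = (x == 0).
Proof. by apply/eqP/eqP => [/(norm_definite hN)|->]; rewrite ?norm_zero. Qed.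

Lemma norm_pos x : (0 < N x) = (x != 0).
Proof. by rewrite lt_neqAle norm_nonneg andbT eq_sym norm_eq0. Qed.

Lemma norm_sum (I : finType) (F : I -> 'cV[R[i]]_n) :
  N (\sum_i F i) <= \sum_i N (F i).
Proof.
elim/big_rec2: _ => [|i x y _ le_yx]; first by rewrite norm_zero.
by rewrite (le_trans (ND _ _))// lerD2l.
Qed.

Lemma norm_sub_le x y : `|N x - N y| <= N (x - y).
Proof.
have := ND (x - y) y; have := ND (y - x) x; rewrite !subrK.
by rewrite -(opprB x y) norm_opp ler_norml => *; apply/andP; split; lra.
Qed.

End Norms.

(** * Equivalence of norms by compactness *)

Section NormEquivalence.
Variables (R : realType) (n : nat) (N : 'cV[R[i]]_n -> R).
Hypothesis hN : is_norm N.

(** Complex vectors are parametrized by real rows of length [n + n], because compactness of closed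
    bounded sets and the extreme value theorem are applied to real row vectors with the max norm. *)
Let real_coordinates (x : 'rV[R]_(n + n)) : 'cV[R[i]]_n :=
  \col_k (x 0 (lshift n k) +i* x 0 (rshift n k)).

Let real_coordinatesB x y :
  real_coordinates (x - y) = real_coordinates x - real_coordinates y.
Proof. by apply/colP => k; rewrite !mxE. Qed.

Let real_coordinatesZ a x :
  real_coordinates (a *: x) = a%:C *: real_coordinates x.
Proof. by apply/colP => k; rewrite !mxE; simpc. Qed.

Let coord_le_norm m (x : 'rV[R]_m) k : `|x 0 k| <= `|x|.
Proof.
rewrite [leRHS]/Num.Def.normr /= mx_normrE.
by apply/bigmax_geP; right => /=; exists (0, k).
Qed.

(** Real and imaginary part are each at most [|x|]; the factor 2 is a crude substitute for the
    square root of 2. *)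
Let modulus_coord_le x k : modulus (real_coordinates x k 0) <= 2 * `|x|.
Proof.
rewrite mxE -(@ler_pXn2r _ 2)// ?nnegrE ?modulus_ge0 ?mulr_ge0//.
rewrite sqr_modulus/= -(real_normK (num_real (x _ (lshift _ _)))).
rewrite -(real_normK (num_real (x _ (rshift _ _)))).
have := coord_le_norm x (lshift n k); have := coord_le_norm x (rshift n k).
set a := `|x 0 _|; set b := `|x 0 _| => ha hb.
have a0 : 0 <= a by exact: normr_ge0.
have b0 : 0 <= b by exact: normr_ge0.
by nra.
Qed.

Let norm_lipschitz :
  exists2 K, 0 < K & forall x, N (real_coordinates x) <= K * `|x|.
Proof.
(* Expand in the standard basis and bound each coordinate by [2 * |x|]; the summand 1 keeps the
   constant positive when the sum is empty. *)
exists (2 * (\sum_k N (delta_mx k 0)) + 1) => [|x].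
  by rewrite ltr_wpDl ?mulr_ge0 ?sumr_ge0// => k _; exact: norm_nonneg.
rewrite (matrix_sum_delta (real_coordinates x)).
rewrite (le_trans (norm_sum hN _))//.
rewrite mulrDl mul1r ler_wpDr// mulr_sumr mulr_suml ler_sum// => k _.
rewrite big_ord1 (norm_homogeneous hN) mulrAC ler_wpM2r ?norm_nonneg//.
Qed.

(* The minimum of [N] on the compact unit sphere of the max norm is positive. *)
Lemma coord_le_of_norm :
  exists2 C, 0 < C & forall (u : 'cV[R[i]]_n) k, modulus (u k 0) <= C * N u.
Proof.
(* For [n = 0] the unit sphere is empty and has no minimizer, but there is no coordinate to bound
   either. *)
have [n0|n_gt0] := posnP n.
  by exists 1 => // u k; exfalso; have := ltn_ord k; rewrite [X in (_ < X)%N]n0.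
pose S := [set x : 'rV[R]_(n + n) | `|x| = 1]%classic.
have [K K0 hK] := norm_lipschitz.
(* By the reverse triangle inequality and [hK], this function is Lipschitz. *)
have cont : continuous (fun x => N (real_coordinates x)).
  move=> x; apply/(@cvgrPdist_lt _ _ _ _ (nbhs_filter x)) => e e0; near=> y.
  rewrite (le_lt_trans (norm_sub_le hN _ _))// -real_coordinatesB.
  rewrite (le_lt_trans (hK _))// mulrC -ltr_pdivlMr//.
  by near: y; apply: cvgr_dist_lt; rewrite ?divr_gt0.
have normS (x : 'rV[R]_(n + n)) : x != 0 -> `| `|x|^-1 *: x | = 1.
  move=> x0; rewrite normrZ normfV normr_id mulVf// normr_eq0//.
have S0 : (S !=set0)%classic.
  pose x1 : 'rV[R]_(n + n) := const_mx 1.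
  have x10 : x1 != 0.
    apply/eqP => /rowP /(_ (lshift n (Ordinal n_gt0))).
    by rewrite !mxE => /eqP; rewrite oner_eq0.
  by exists (`|x1|^-1 *: x1); exact: normS.
have cS : compact S.
  apply: bounded_closed_compact.
    exists 1; split; first exact: real1.
    by move=> M M1 x /= ->; exact: ltW.
  have -> : S = (Num.Def.normr @^-1` [set (1 : R)])%classic by [].
  apply: preimage_closed; last exact: closed_eq.
  by move=> x _; exact: norm_continuous.
have [x0 x0S x0min] := EVT_min_rV S0 cS (continuous_subspaceT cont).
set m := N (real_coordinates x0) in x0min.
have real0 x : real_coordinates x = 0 -> x = 0.
  move=> x_0; apply/rowP => i; rewrite mxE; case: (split_ordP i) => k ->;
    by move/colP/(_ k): x_0; rewrite !mxE => /eqP; rewrite eq_complex/=;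
      case/andP => /eqP + /eqP.
have m0 : 0 < m.
  rewrite norm_pos//; apply/eqP => /real0 x00.
  by move: x0S; rewrite inE /S/= x00 normr0 => /esym/eqP; rewrite oner_eq0.
(* Homogeneity carries the minimum [m] on the sphere over to all vectors. *)
have lower x : m * `|x| <= N (real_coordinates x).
  have [->|xn0] := eqVneq x 0; first by rewrite normr0 mulr0 norm_nonneg.
  have := x0min (`|x|^-1 *: x); rewrite inE => /(_ (normS _ xn0)).
  rewrite real_coordinatesZ norm_real// normfV normr_id mulrC.
  by rewrite ler_pdivlMr ?normr_gt0.
(* The 2 comes from [modulus_coord_le], the [1 / m] from [lower]. *)
exists (2 / m) => [|u k]; first by rewrite divr_gt0.
pose x : 'rV[R]_(n + n) :=
  row_mx (map_mx (@complex.Re R) u)^T (map_mx (@complex.Im R) u)^T.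
have ux : u = real_coordinates x.
  apply/colP => l; rewrite mxE row_mxEl row_mxEr !mxE.
  by case: (u l 0).
rewrite [in leRHS]ux (le_trans _ (ler_wpM2l _ (lower x)))//; last first.
  by rewrite divr_ge0// ltW.
by rewrite mulrA divfK ?gt_eqF// ux modulus_coord_le.
Unshelve. all: by end_near.
Qed.

End NormEquivalence.

(** [half] gives one inequality and the transfer of boundedness; applying it to [c] and then to
    [c^-1] gives equality. On an empty or unbounded set both suprema take the default value 0. *)
Lemma sup_scale (R : realType) (T : Type) (D : set T) (f : T -> R) (c : R) :
  0 < c ->
  sup [set c * f x | x in D]%classic = c * sup [set f x | x in D]%classic.
Proof.
have half (h : T -> R) (d : R) : 0 < d -> (D !=set0)%classic ->
    has_ubound [set h x | x in D]%classic ->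
    has_ubound [set d * h x | x in D]%classic /\
    sup [set d * h x | x in D]%classic <= d * sup [set h x | x in D]%classic.
  move=> d0 D0 hub.
  have ub : ubound [set d * h x | x in D]%classic
      (d * sup [set h x | x in D]%classic).
    by move=> _ [x Dx <-]; rewrite ler_pM2l//; apply: ub_le_sup => //; exists x.
  split; first by exists (d * sup [set h x | x in D]%classic).
  by apply: ge_sup ub; have [x Dx] := D0; exists (d * h x), x.
move=> c0.
have fE : f = (fun x => c^-1 * (c * f x)).
  by apply/funext => x; rewrite mulKf// gt_eqF.
have [D0|/set0P/negP/negPn/eqP D0] := pselect (D !=set0)%classic; last first.
  by rewrite D0 !image_set0 sup0 mulr0.
have [hub|nub] := pselect (has_ubound [set f x | x in D]%classic).
  have [hub' le1] := half f c c0 D0 hub.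
  apply/eqP; rewrite eq_le le1 /= -ler_pdivlMl//.
  have c0' : 0 < c^-1 by rewrite invr_gt0.
  by have [_] := half _ _ c0' D0 hub'; rewrite -fE.
rewrite sup_out; last first.
  move=> [_ hub']; apply: nub.
  have c0' : 0 < c^-1 by rewrite invr_gt0.
  by have [] := half _ _ c0' D0 hub'; rewrite -fE.
by rewrite sup_out ?mulr0// => -[].
Qed.

(** * Induced norms of rows and matrices *)

Section DualNorms.
Variables (R : realType) (n : nat) (N : 'cV[R[i]]_n -> R).
Hypothesis hN : is_norm N.
Implicit Types (b : 'rV[R[i]]_n) (B : 'M[R]_n) (c : R).

Lemma norm_normalize (u : 'cV[R[i]]_n) : u != 0 -> N ((N u)^-1%:C *: u) = 1.
Proof.
move=> u0; rewrite norm_real// normfV ger0_norm ?norm_nonneg// mulVf//.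
by rewrite norm_eq0.
Qed.

Lemma delta_col_neq0 (k : 'I_n) : (delta_mx k 0 : 'cV[R[i]]_n) != 0.
Proof.
by apply/eqP => /colP/(_ k); rewrite !mxE !eqxx => /eqP; rewrite oner_eq0.
Qed.

Let delta_norm (k : 'I_n) : R := N (delta_mx k 0).
Let unit_col (k : 'I_n) : 'cV[R]_n := (delta_norm k)^-1 *: delta_mx k 0.

Let toC_unit_col k : toC (unit_col k) = (delta_norm k)^-1%:C *: delta_mx k 0.
Proof. by rewrite map_mxZ map_delta_mx. Qed.

Let norm_unit_col k : N (toC (unit_col k)) = 1.
Proof. by rewrite toC_unit_col norm_normalize// delta_col_neq0. Qed.

Lemma unit_sphere_nonempty (k : 'I_n) : exists u : 'cV[R]_n, N (toC u) = 1.
Proof. by exists (unit_col k). Qed.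

Lemma row_bounded b :
  exists K, forall u : 'cV[R[i]]_n, modulus ((b *m u) 0 0) <= K * N u.
Proof.
have [C C0 hC] := coord_le_of_norm hN.
exists (\sum_k modulus (b 0 k) * C) => u; rewrite mxE mulr_suml.
elim/big_rec2: _ => [|k x y _ le_yx]; first by rewrite modulus0.
rewrite (le_trans (le_normcD _ _))// lerD//.
by rewrite modulusM -mulrA ler_wpM2l ?modulus_ge0.
Qed.

Let rownormC_ubound b : has_ubound
  [set modulus ((b *m u) 0 0) | u in [set u : 'cV[R[i]]_n | N u = 1]]%classic.
Proof.
by have [K hK] := row_bounded b; exists K => _ [u /= u1 <-]; rewrite -[K]mulr1 -u1.
Qed.

Let rownormR_ubound b : has_ubound
  [set modulus ((b *m toC u) 0 0) | u in [set u : 'cV[R]_n | N (toC u) = 1]]%classic.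
Proof.
by have [K hK] := row_bounded b; exists K => _ [u /= u1 <-]; rewrite -[K]mulr1 -u1.
Qed.

Let modulus_row_unit_col b k :
  modulus ((b *m toC (unit_col k)) 0 0) = (delta_norm k)^-1 * modulus (b 0 k).
Proof.
rewrite toC_unit_col -scalemxAr mxE modulusM modulus_real normfV.
rewrite ger0_norm ?norm_nonneg//; congr (_ * modulus _).
by rewrite -colE mxE.
Qed.

(** A normalized coordinate vector detects a nonzero entry of [b]. Being real, it is admissible in
    both [rownormR] and [rownormC], so that both are positive. *)
Let row_unit_col_gt0 b : b != 0 ->
  exists k, 0 < modulus ((b *m toC (unit_col k)) 0 0).
Proof.
case/rV0Pn => k bk; exists k; rewrite modulus_row_unit_col mulr_gt0 ?modulus_gt0//.
by rewrite invr_gt0 norm_pos// delta_col_neq0.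
Qed.

Lemma rownormR_gt0 b : b != 0 -> 0 < rownormR N b.
Proof.
move=> /row_unit_col_gt0[k /lt_le_trans]; apply.
apply: ub_le_sup; first exact: rownormR_ubound.
by exists (unit_col k) => /=.
Qed.

Lemma rownormC_gt0 b : b != 0 -> 0 < rownormC N b.
Proof.
move=> /row_unit_col_gt0[k /lt_le_trans]; apply.
apply: ub_le_sup; first exact: rownormC_ubound.
by exists (toC (unit_col k)) => /=.
Qed.

Lemma modulus_row_le b (u : 'cV[R[i]]_n) :
  modulus ((b *m u) 0 0) <= rownormC N b * N u.
Proof.
have [->|u0] := eqVneq u 0; first by rewrite mulmx0 mxE modulus0 norm_zero// mulr0.
rewrite -ler_pdivrMr ?norm_pos//; apply: ub_le_sup; first exact: rownormC_ubound.
exists ((N u)^-1%:C *: u) => /=; first exact: norm_normalize.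
by rewrite -scalemxAr mxE modulusM modulus_real mulrC normfV ger0_norm ?norm_nonneg.
Qed.

Lemma rownormCZ b c : 0 < c -> rownormC N (c%:C *: b) = c * rownormC N b.
Proof.
move=> c0; rewrite -sup_scale//; congr sup; apply: eq_imagel => u _ /=.
by rewrite -scalemxAl mxE modulusM modulus_real gtr0_norm.
Qed.

Lemma opnormZ B c : 0 < c -> opnorm N (c *: B) = c * opnorm N B.
Proof.
move=> c0; rewrite -sup_scale//; congr sup; apply: eq_imagel => u _ /=.
by rewrite -scalemxAl map_mxZ norm_real// gtr0_norm.
Qed.

(** The index [k] witnesses [0 < n], hence a nonempty unit sphere, as the least upper bound property
    requires. *)
Lemma opnorm_le B c (k : 'I_n) :
  (forall u, N (toC u) = 1 -> N (toC (B *m u)) <= c) -> opnorm N B <= c.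
Proof.
move=> hB; apply: ge_sup; last by move=> _ [u /= u1 <-]; exact: hB.
by have [u u1] := unit_sphere_nonempty k; exists (N (toC (B *m u))), u.
Qed.

(** The bound [c] makes the set bounded above, so that its [sup] is a genuine upper bound and not
    the default value. *)
Lemma norm_le_opnorm B c (u : 'cV[R]_n) :
  (forall u, N (toC u) = 1 -> N (toC (B *m u)) <= c) ->
  N (toC u) = 1 -> N (toC (B *m u)) <= opnorm N B.
Proof.
move=> hB u1; apply: ub_le_sup; last by exists u.
by exists c => _ [v /= v1 <-]; exact: hB.
Qed.

End DualNorms.

(** * Modes *)

Section RealPart.
Variable R : realType.

Lemma re_mx_mulr m n p (B : 'M[R[i]]_(m, n)) (u : 'M[R]_(n, p)) :
  re_mx (B *m toC u) = re_mx B *m u.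
Proof.
apply/matrixP => i k; rewrite !mxE raddf_sum; apply: eq_bigr => l _.
by rewrite /= !mxE Re_Mreal.
Qed.

Lemma re_mxZ m n (a : R) (B : 'M[R[i]]_(m, n)) : re_mx (a%:C *: B) = a *: re_mx B.
Proof. by apply/matrixP => i k; rewrite !mxE Re_realM. Qed.

Lemma re_mxK m n (B : 'M[R[i]]_(m, n)) :
  B \is a mxOver Num.real -> toC (re_mx B) = B.
Proof. by move/mxOverP => Breal; apply/matrixP => i k; rewrite !mxE RRe_real. Qed.

Lemma mulmx_rank1 m n (v : 'cV[R[i]]_m) (w : 'rV[R[i]]_n) (u : 'cV[R[i]]_n) :
  v *m w *m u = (w *m u) 0 0 *: v.
Proof.
by rewrite -mulmxA {1}[w *m u]mx11_scalar mul_mx_scalar.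
Qed.

End RealPart.

Section Modes.
Variables (R : realType) (n : nat) (N : 'cV[R[i]]_n -> R) (m : mode R n).
Hypothesis hN : is_norm N.
Hypotheses (vec_neq0 : vec m != 0) (row_vec_neq0 : row_vec m != 0).

Lemma row_vec_norm_gt0 : 0 < row_vec_norm N m.
Proof.
rewrite /row_vec_norm; case: ifP => _; [exact: rownormR_gt0|exact: rownormC_gt0].
Qed.

Lemma f_gt0 : 0 < f_ N m.
Proof. by rewrite mulr_gt0 ?row_vec_norm_gt0// norm_pos. Qed.

Lemma vecE : vec m = (N (vec m))%:C *: vhat N m.
Proof. by rewrite scalerA -rmorphM /= divff ?scale1r// norm_eq0. Qed.

Lemma row_vecE : row_vec m = (row_vec_norm N m)%:C *: what N m.
Proof.
by rewrite scalerA -rmorphM /= divff ?scale1r// gt_eqF// row_vec_norm_gt0.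
Qed.

Lemma norm_vhat : N (vhat N m) = 1.
Proof. exact: norm_normalize. Qed.

Lemma row_vec_appE u :
  (row_vec m *m toC u) 0 0 = (row_vec_norm N m)%:C * what_app N m u.
Proof. by rewrite {1}row_vecE -scalemxAl mxE. Qed.

Section RealMode.
Hypothesis lam_real : lam m \is Num.real.
Hypotheses (vec_real : vec m \is a mxOver Num.real)
           (row_vec_real : row_vec m \is a mxOver Num.real).

Let Q_mul t u : toC (Q_ m t *m u) = (row_vec m *m toC u) 0 0 *: vec m.
Proof.
rewrite /Q_ lam_real map_mxM /= re_mxK ?mulmx_rank1//.
by apply: mxOverM.
Qed.

Lemma norm_Q_real t u : N (toC (Q_ m t *m u)) = f_ N m * modulus (what_app N m u).
Proof.
rewrite Q_mul (norm_homogeneous hN) row_vec_appE modulusM modulus_real.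
by rewrite gtr0_norm ?row_vec_norm_gt0// mulrAC.
Qed.

(** [Q_ m t] sends every real [u] to a multiple of [vec m], so the supremum is [N (vec m)] times the
    one over real unit vectors that defines [rownormR]. *)
Lemma opnorm_Q_real t : opnorm N (Q_ m t) = f_ N m.
Proof.
rewrite /f_ /row_vec_norm lam_real mulrC -sup_scale ?norm_pos//.
congr sup; apply: eq_imagel => u _ /=.
by rewrite Q_mul (norm_homogeneous hN) mulrC.
Qed.

End RealMode.

Section ComplexMode.
Hypothesis lam_nonreal : lam m \isn't Num.real.
Variables (alpha beta : 'I_n -> R) (gamma : 'cV[R]_n -> R).
Hypothesis halpha : forall k, is_angle (vhat N m k 0) (alpha k).
Hypothesis hbeta : forall l, is_angle (what N m 0 l) (beta l).

Lemma rownormC_what : rownormC N (what N m) = 1.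
Proof.
rewrite rownormCZ ?invr_gt0 ?row_vec_norm_gt0//.
have := row_vec_norm_gt0; rewrite /row_vec_norm (negPf lam_nonreal) => rn0.
by rewrite mulVf// gt_eqF.
Qed.

(** Writing [vhat] in polar form collects the three angles in one [cis], whose real part is the
    cosine. *)
Lemma Theta_vecE t u : Theta_vec N m alpha gamma t u =
  re_mx ((cis (omega m * t) * cis (gamma u)) *: vhat N m).
Proof.
apply/colP => k; rewrite [LHS]mxE [RHS]mxE [X in complex.Re X]mxE {2}halpha.
by rewrite mulrCA -!cisD Re_realM /= addrAC.
Qed.

Lemma Theta_mxE t : Theta_mx N m alpha beta t =
  re_mx (cis (omega m * t) *: (vhat N m *m what N m)).
Proof.
apply/matrixP => k l; rewrite [LHS]mxE [RHS]mxE [X in complex.Re X]mxE.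
rewrite [(vhat N m *m what N m) k l]mxE big_ord1 {2}halpha {2}hbeta.
rewrite mulrACA -rmorphM [X in complex.Re X]mulrCA -!cisD Re_realM /=.
by rewrite addrA.
Qed.

Lemma Q_complexE t : Q_ m t = (2 * f_ N m) *: Theta_mx N m alpha beta t.
Proof.
rewrite Theta_mxE /Q_ (negPf lam_nonreal) {1}vecE {1}row_vecE.
rewrite -scalemxAl -scalemxAr; set X := vhat N m *m what N m.
have -> : cis (omega m * t) *: ((N (vec m))%:C *: ((row_vec_norm N m)%:C *: X)) =
    (f_ N m)%:C *: (cis (omega m * t) *: X).
  by rewrite !scalerA /f_ rmorphM; congr (_ *: _); rewrite /=; ring.
by rewrite re_mxZ scalerA.
Qed.

Lemma Q_complex_mulE t u : is_angle (what_app N m u) (gamma u) ->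
  Q_ m t *m u =
  (2 * f_ N m * modulus (what_app N m u)) *: Theta_vec N m alpha gamma t u.
Proof.
move=> hgamma; rewrite Q_complexE -scalemxAl Theta_mxE -re_mx_mulr.
rewrite -scalemxAl mulmx_rank1 -/(what_app N m u) {1}hgamma Theta_vecE.
rewrite -!re_mxZ !scalerA; congr re_mx; congr (_ *: _).
by rewrite [in RHS]rmorphM /=; ring.
Qed.

End ComplexMode.

End Modes.

(** * Estimates for p-norms and the Euclidean norm *)

Section PNorm.
Variables (R : realType) (n : nat).

Lemma pnorm_le (p : \bar R) (x y : 'cV[R[i]]_n) : (1 <= p)%E ->
  (forall k, modulus (x k 0) <= modulus (y k 0)) -> pnorm p x <= pnorm p y.
Proof.
case: p => [r r1|_|//] hxy /=; last first.
  apply: le_bigmax2 => k _; exact: hxy.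
have r0 : 0 <= r by rewrite (le_trans ler01).
apply: ge0_ler_powR; rewrite ?invr_ge0 ?nnegrE ?sumr_ge0//.
- by move=> k _; exact: powR_ge0.
- by move=> k _; exact: powR_ge0.
by apply: ler_sum => k _; apply: ge0_ler_powR; rewrite ?nnegrE ?modulus_ge0.
Qed.

End PNorm.

(** * Bounds for norms that are monotone in the moduli of the entries *)

Section MonotoneNorm.
Variables (R : realType) (n : nat) (N : 'cV[R[i]]_n -> R) (m : mode R n).
Hypothesis hN : is_norm N.
Hypothesis N_monotone : forall x y : 'cV[R[i]]_n,
  (forall k, modulus (x k 0) <= modulus (y k 0)) -> N x <= N y.
Hypotheses (vec_neq0 : vec m != 0) (row_vec_neq0 : row_vec m != 0).
Hypothesis lam_nonreal : lam m \isn't Num.real.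

Lemma norm_re_vhat_le1 (c : R[i]) :
  modulus c <= 1 -> N (toC (re_mx (c *: vhat N m))) <= 1.
Proof.
move=> c1; rewrite -(norm_vhat hN vec_neq0); apply: N_monotone => k.
rewrite 3!mxE modulus_real (le_trans (Re_le_modulus _))// modulusM.
by rewrite ler_piMl ?modulus_ge0.
Qed.

(** On a unit vector [u] the matrix gives the real part of a scalar times [vhat]; the scalar
    [c * (what u)] has modulus at most 1 because [what] has complex dual norm 1. *)
Lemma opnorm_re_le1 (c : R[i]) (k : 'I_n) :
  modulus c <= 1 -> opnorm N (re_mx (c *: (vhat N m *m what N m))) <= 1.
Proof.
move=> c1; apply: opnorm_le => // u u1.
rewrite -re_mx_mulr -scalemxAl mulmx_rank1 scalerA.
apply: norm_re_vhat_le1; rewrite modulusM mulr_ile1 ?modulus_ge0//.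
by rewrite (le_trans (modulus_row_le hN _ _))// u1 rownormC_what ?mulr1.
Qed.

End MonotoneNorm.

(** * Pairing a complex unit vector with real unit vectors *)

Section RealPairing.
Variables (R : realType) (I : finType) (z : I -> R[i]).
Hypothesis z1 : \sum_i modulus (z i) ^+ 2 = 1.
Let S : R := modulus (\sum_i z i ^+ 2).

(** With the half phase, the squared imaginary parts sum to [(1 - S) / 2]. *)
Lemma modulus_sum_sqr_le1 : S <= 1.
Proof.
have [c c1 cS] := exists_half_phase (\sum_i z i ^+ 2).
have : 0 <= \sum_i complex.Im (c * z i) ^+ 2.
  by apply: sumr_ge0 => i _; exact: sqr_ge0.
by rewrite sum_sqr_Im// z1 cS pmulr_lge0 ?invr_gt0// subr_ge0.
Qed.

Lemma Re_pairing c (u : I -> R) :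
  complex.Re (c * \sum_i z i * (u i)%:C) = \sum_i complex.Re (c * z i) * u i.
Proof.
rewrite mulr_sumr raddf_sum; apply: eq_bigr => i _.
by rewrite /= mulrA Re_Mreal.
Qed.

(** A phase [c] makes the pairing real, so it equals the pairing of [u] with the real part of [c z],
    whose squared length is at most [(1 + S) / 2]. *)
Lemma sqr_real_pairing_le (u : I -> R) : \sum_i u i ^+ 2 = 1 ->
  modulus (\sum_i z i * (u i)%:C) ^+ 2 <= (1 + S) / 2.
Proof.
move=> u1; have [c c1 cs] := exists_phase (\sum_i z i * (u i)%:C).
rewrite (_ : modulus _ = \sum_i complex.Re (c * z i) * u i); last first.
  by rewrite -Re_pairing cs.
have := Cauchy_Schwarz_sum (fun i => complex.Re (c * z i)) u.
rewrite u1 sqrtr1 mulr1 => le1.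
(* The opposite sign, to bound the absolute value. *)
have := Cauchy_Schwarz_sum (fun i => - complex.Re (c * z i)) u.
under eq_bigr do rewrite mulNr.
under [X in _ <= Num.sqrt X * _]eq_bigr do rewrite sqrrN.
rewrite u1 sqrtr1 mulr1 sumrN => le2.
have S0 : 0 <= \sum_i complex.Re (c * z i) ^+ 2.
  by apply: sumr_ge0 => i _; exact: sqr_ge0.
apply: (@le_trans _ _ (\sum_i complex.Re (c * z i) ^+ 2)); last first.
  by have := sum_sqr_Re_le z c1; rewrite z1.
rewrite -[leRHS](sqr_sqrtr S0) -real_normK ?num_real//.
by rewrite lerXn2r ?nnegrE ?normr_ge0 ?sqrtr_ge0// ler_norml lerNl le1 le2.
Qed.

(** This is the equality case of Cauchy-Schwarz: [u] is the normalized real part of [c z], where the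
    half phase [c] makes that real part as long as possible. *)
Lemma exists_sqr_real_pairing_ge : exists2 u : I -> R, \sum_i u i ^+ 2 = 1 &
  (1 + S) / 2 <= modulus (\sum_i z i * (u i)%:C) ^+ 2.
Proof.
have [c c1 cS] := exists_half_phase (\sum_i z i ^+ 2).
have P : \sum_i complex.Re (c * z i) ^+ 2 = (1 + S) / 2.
  by rewrite sum_sqr_Re// z1 cS.
have P0 : 0 < (1 + S) / 2 by rewrite divr_gt0// ltr_pwDl ?modulus_ge0.
set Q := (1 + S) / 2 in P P0 *; set q := Num.sqrt Q.
have q0 : 0 < q by rewrite sqrtr_gt0.
have qQ : q ^+ 2 = Q by rewrite sqr_sqrtr// ltW.
exists (fun i => complex.Re (c * z i) / q).
  under eq_bigr do rewrite expr_div_n.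
  by rewrite -mulr_suml P qQ divff// gt_eqF.
rewrite -qQ lerXn2r ?nnegrE ?modulus_ge0 ?(ltW q0)//.
rewrite -[modulus _]mul1r -{1}c1 -modulusM.
rewrite (le_trans _ (Re_le_modulus _))// (le_trans _ (ler_norm _))// Re_pairing.
under eq_bigr do rewrite mulrA -expr2.
by rewrite -mulr_suml P -qQ expr2 mulfK// gt_eqF.
Qed.

End RealPairing.

(** * Euclidean norms of real parts of vectors and rank-one matrices *)

Section Euclidean.
Variables (R : realType) (n : nat).
Local Notation eu := (@euclidean_norm R n).

Lemma sqr_euclidean (x : 'cV[R[i]]_n) : eu x ^+ 2 = \sum_k modulus (x k 0) ^+ 2.
Proof. by rewrite sqr_sqrtr// sumr_ge0// => k _; exact: sqr_ge0. Qed.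

Lemma sqr_euclidean_real (x : 'cV[R]_n) : eu (toC x) ^+ 2 = \sum_k x k 0 ^+ 2.
Proof.
rewrite sqr_euclidean; apply: eq_bigr => k _.
by rewrite mxE modulus_real real_normK ?num_real.
Qed.

Lemma euclidean_real_eq1 (x : 'cV[R]_n) : eu (toC x) = 1 <-> \sum_k x k 0 ^+ 2 = 1.
Proof.
rewrite -sqr_euclidean_real; split=> [->|/eqP]; first exact: expr1n.
rewrite sqrf_eq1 => /orP[/eqP//|/eqP x1].
have := sqrtr_ge0 (\sum_k modulus (toC x k 0) ^+ 2).
by rewrite -/(eu _) x1 ler0N1.
Qed.

(** The Euclidean norm is self-dual: Cauchy-Schwarz gives [1 <= sqrt s], and testing [w] on its
    conjugate transpose gives [s <= sqrt s]. *)
Lemma sum_sqr_of_rownormC_eq1 (w : 'rV[R[i]]_n) : is_norm eu ->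
  w != 0 -> rownormC eu w = 1 -> \sum_l modulus (w 0 l) ^+ 2 = 1.
Proof.
move=> hN w0 w1; set s := \sum_l _.
have s0 : 0 <= s by apply: sumr_ge0 => l _; exact: sqr_ge0.
have le1s : 1 <= Num.sqrt s.
  rewrite -w1; apply: ge_sup.
    have /rV0Pn[k _] := w0; have [u u1] := unit_sphere_nonempty hN k.
    by exists (modulus ((w *m toC u) 0 0)), (toC u).
  move=> _ [u /= u1 <-]; rewrite mxE.
  apply: (@le_trans _ _ (\sum_l modulus (w 0 l) * modulus (u l 0))).
    elim/big_rec2: _ => [|k x y _ le_yx]; first by rewrite modulus0.
    by rewrite (le_trans (le_normcD _ _))// modulusM lerD.
  by rewrite (le_trans (Cauchy_Schwarz_sum _ _))// -[X in _ * X]/(eu u) u1 mulr1.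
pose u := map_mx (@conjc R) w^T.
have eu_u : eu u = Num.sqrt s.
  by congr Num.sqrt; apply: eq_bigr => l _; rewrite !mxE modulus_conjc.
have wu : (w *m u) 0 0 = s%:C.
  rewrite mxE rmorph_sum; apply: eq_bigr => l _.
  by rewrite !mxE mulrC conjcM_modulus.
have := modulus_row_le hN w u; rewrite wu modulus_real ger0_norm// w1 mul1r eu_u.
rewrite -{1}(sqr_sqrtr s0) => les1; apply/eqP.
rewrite -(sqr_sqrtr s0) sqrf_eq1; apply/orP; left; rewrite eq_le le1s andbT.
by move: les1; rewrite expr2 ger_pMl// (lt_le_trans ltr01).
Qed.

Variables (v : 'cV[R[i]]_n) (w : 'rV[R[i]]_n).
Hypothesis v1 : \sum_k modulus (v k 0) ^+ 2 = 1.
Hypothesis w1 : \sum_l modulus (w 0 l) ^+ 2 = 1.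
Let SV : R := modulus (\sum_k v k 0 ^+ 2).
Let SW : R := modulus (\sum_l w 0 l ^+ 2).

Let SV0 : 0 <= SV := modulus_ge0 _.
Let SW0 : 0 <= SW := modulus_ge0 _.
Let SV1 : SV <= 1 := modulus_sum_sqr_le1 v1.
Let SW1 : SW <= 1 := modulus_sum_sqr_le1 w1.

Let sqr_euclidean_re (c : R[i]) :
  eu (toC (re_mx (c *: v))) ^+ 2 = \sum_k complex.Re (c * v k 0) ^+ 2.
Proof. by rewrite sqr_euclidean_real; apply: eq_bigr => k _; rewrite !mxE. Qed.

Lemma sqr_euclidean_re_le c : modulus c = 1 ->
  eu (toC (re_mx (c *: v))) ^+ 2 <= (1 + SV) / 2.
Proof.
move=> c1; rewrite sqr_euclidean_re.
by have := sum_sqr_Re_le (fun k => v k 0) c1; rewrite v1.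
Qed.

Lemma sqr_euclidean_re_ge c : modulus c = 1 ->
  (1 - SV) / 2 <= eu (toC (re_mx (c *: v))) ^+ 2.
Proof.
move=> c1; rewrite sqr_euclidean_re.
by have := sum_sqr_Re_ge (fun k => v k 0) c1; rewrite v1.
Qed.

Variable (c : R[i]).
Hypothesis c1 : modulus c = 1.
Let T : 'M[R]_n := re_mx (c *: (v *m w)).

(** [T u] is the real part of [c (w u) v]; the modulus of [w u] factors out and its phase is
    absorbed into [e]. The estimates for [v] and for [w] thus separate. *)
Let sqr_T_mul (u : 'cV[R]_n) : exists2 e, modulus e = 1 & eu (toC (T *m u)) ^+ 2 =
  modulus ((w *m toC u) 0 0) ^+ 2 * eu (toC (re_mx (e *: v))) ^+ 2.
Proof.
have [e e1 se] := polar_decomposition ((w *m toC u) 0 0).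
exists (c * e); first by rewrite modulusM c1 e1 mulr1.
rewrite /T -re_mx_mulr -scalemxAl mulmx_rank1 {1}se scalerA mulrCA -scalerA re_mxZ.
rewrite !sqr_euclidean_real mulr_sumr; apply: eq_bigr => k _.
by rewrite [in LHS]mxE exprMn.
Qed.

Let row_pairing (u : 'cV[R]_n) : (w *m toC u) 0 0 = \sum_l w 0 l * (u l 0)%:C.
Proof. by rewrite mxE; apply: eq_bigr => l _; rewrite mxE. Qed.

Lemma sqr_euclidean_rank1_le (u : 'cV[R]_n) : eu (toC u) = 1 ->
  eu (toC (T *m u)) ^+ 2 <= (1 + SV) * (1 + SW) / 4.
Proof.
move=> /euclidean_real_eq1 u1; have [e e1 ->] := sqr_T_mul u.
have le1 := sqr_euclidean_re_le e1.
have := sqr_real_pairing_le w1 u1; rewrite -row_pairing -/SW => le2.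
apply: (@le_trans _ _ ((1 + SW) / 2 * ((1 + SV) / 2))).
  by apply: ler_pM => //; exact: sqr_ge0.
by rewrite le_eqVlt; apply/orP; left; apply/eqP; field.
Qed.

Lemma euclidean_rank1_le (u : 'cV[R]_n) : eu (toC u) = 1 ->
  eu (toC (T *m u)) <= Num.sqrt ((1 + SV) * (1 + SW) / 4).
Proof.
move=> u1; rewrite -(@ler_pXn2r _ 2)// ?nnegrE ?sqrtr_ge0//.
have a0 : 0 <= (1 + SV) * (1 + SW) / 4.
  by rewrite divr_ge0// mulr_ge0// addr_ge0.
by rewrite (sqr_sqrtr a0); exact: sqr_euclidean_rank1_le.
Qed.

Lemma sqr_opnorm_euclidean_le (k : 'I_n) : is_norm eu ->
  opnorm eu T ^+ 2 <= (1 + SV) * (1 + SW) / 4.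
Proof.
move=> hN.
have a0 : 0 <= (1 + SV) * (1 + SW) / 4.
  by rewrite divr_ge0// mulr_ge0// addr_ge0.
have [u u1] := unit_sphere_nonempty hN k.
rewrite -[leRHS](sqr_sqrtr a0) lerXn2r ?nnegrE ?sqrtr_ge0//.
  rewrite (le_trans (norm_nonneg hN (toC (T *m u))))//.
  exact: norm_le_opnorm euclidean_rank1_le u1.
exact: opnorm_le euclidean_rank1_le.
Qed.

Let le_sqr_opnorm x u : is_norm eu -> eu (toC u) = 1 ->
  x <= eu (toC (T *m u)) ^+ 2 -> x <= opnorm eu T ^+ 2.
Proof.
move=> hN u1 /le_trans; apply; have := norm_le_opnorm euclidean_rank1_le u1.
move=> le1; rewrite lerXn2r ?nnegrE ?norm_nonneg//.
by rewrite (le_trans (norm_nonneg hN (toC (T *m u)))).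
Qed.

(* Aim [u] at the long axis of [w]. *)
Lemma sqr_opnorm_euclidean_ge_row : is_norm eu ->
  (1 - SV) * (1 + SW) / 4 <= opnorm eu T ^+ 2.
Proof.
move=> hN; have [u u1] := exists_sqr_real_pairing_ge w1; rewrite -/SW => le1.
pose x := \col_l u l.
have x1 : eu (toC x) = 1.
  by apply/euclidean_real_eq1; rewrite -u1; apply: eq_bigr => l _; rewrite mxE.
apply: le_sqr_opnorm x1 _ => //; have [e e1 ->] := sqr_T_mul x.
have le2 := sqr_euclidean_re_ge e1.
apply: (@le_trans _ _ ((1 + SW) / 2 * ((1 - SV) / 2))).
  by rewrite le_eqVlt; apply/orP; left; apply/eqP; field.
apply: ler_pM => //; rewrite ?divr_ge0 ?subr_ge0 ?addr_ge0//.
rewrite (_ : (w *m toC x) 0 0 = \sum_l w 0 l * (u l)%:C)//.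
by rewrite row_pairing; apply: eq_bigr => l _; rewrite mxE.
Qed.

(* Test [T] against a unit vector [y] along the long axis of [v]. *)
Lemma sqr_opnorm_euclidean_ge_col : is_norm eu ->
  (1 + SV) * (1 - SW) / 4 <= opnorm eu T ^+ 2.
Proof.
move=> hN; have [y y1] := exists_sqr_real_pairing_ge v1; rewrite -/SV.
set q := \sum_k _ => le1.
have [e e1 qe] := polar_decomposition q.
(* [z] is the row obtained by multiplying [T] on the left by the transpose of [y]; [q] is the
   pairing of [y] with [v]. *)
pose z l := modulus q * complex.Re (c * e * w 0 l).
have zE l : z l = \sum_k y k * T k l.
  have -> : z l = complex.Re (c * w 0 l * q).
    by rewrite /z -Re_realM {2}qe; congr complex.Re; rewrite /=; ring.
  rewrite mulr_sumr raddf_sum; apply: eq_bigr => k _ /=.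
  by rewrite !mxE big_ord1 mulrA Re_Mreal mulrC; congr (_ * complex.Re _); ring.
pose Z := \sum_l z l ^+ 2.
have Zge : (1 + SV) * (1 - SW) / 4 <= Z.
  apply: (@le_trans _ _ ((1 + SV) / 2 * ((1 - SW) / 2))).
    by rewrite le_eqVlt; apply/orP; left; apply/eqP; field.
  rewrite /Z /z; under eq_bigr do rewrite exprMn.
  rewrite -mulr_sumr; apply: ler_pM => //; rewrite ?divr_ge0 ?subr_ge0 ?addr_ge0//.
  have ce1 : modulus (c * e) = 1 by rewrite modulusM c1 e1 mulr1.
  by have := sum_sqr_Re_ge (fun l => w 0 l) ce1; rewrite w1.
apply: (le_trans Zge).
have Z0 : 0 <= Z by apply: sumr_ge0 => l _; exact: sqr_ge0.
(* A zero row cannot be normalized, but then the bound is trivial. *)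
have [->|Zn0] := eqVneq Z 0; first exact: sqr_ge0.
have sZ0 : 0 < Num.sqrt Z by rewrite sqrtr_gt0 lt_neqAle eq_sym Zn0.
pose x := \col_l (z l / Num.sqrt Z).
have x1 : eu (toC x) = 1.
  apply/euclidean_real_eq1; under eq_bigr do rewrite mxE expr_div_n sqr_sqrtr//.
  by rewrite -mulr_suml divff.
apply: le_sqr_opnorm x1 _ => //.
rewrite -{1}(sqr_sqrtr Z0) lerXn2r ?nnegrE ?sqrtr_ge0 ?norm_nonneg//.
(* As [y] is a unit vector, the norm of [T x] is at least the pairing of [y] with [T x], which is
   that of [z] with [x], namely [sqrt Z]. *)
have := Cauchy_Schwarz_sum y (fun k => (T *m x) k 0).
rewrite y1 sqrtr1 mul1r -sqr_euclidean_real sqrtr_sqr ger0_norm ?norm_nonneg//.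
apply: le_trans.
under eq_bigr do rewrite mxE mulr_sumr.
rewrite exchange_big /=.
under eq_bigr => l _.
  under eq_bigr => k _ do rewrite mulrA.
  rewrite -mulr_suml -zE mxE mulrA -expr2.
  over.
by rewrite -mulr_suml -/Z -{2}(sqr_sqrtr Z0) expr2 mulfK// gt_eqF.
Qed.

(* [a_ SV SW] is the larger of [(1 - SV) * (1 + SW)] and [(1 + SV) * (1 - SW)]. *)
Lemma sqr_opnorm_euclidean_ge : is_norm eu -> a_ SV SW / 4 <= opnorm eu T ^+ 2.
Proof.
move=> hN; rewrite /a_; case: ifP => _; [exact: sqr_opnorm_euclidean_ge_row|].
exact: sqr_opnorm_euclidean_ge_col.
Qed.

End Euclidean.

(* If equality held, a unit multiple of [v] would be a real eigenvector of the
   real matrix [A] for a non-real eigenvalue. *)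
Lemma modulus_sum_sqr_eigenvector (R : realType) n (A : 'M[R]_n) (l : R[i])
    (v : 'cV[R[i]]_n) : is_eigenvector A l v -> complex.Im l != 0 ->
  \sum_k modulus (v k 0) ^+ 2 = 1 -> modulus (\sum_k v k 0 ^+ 2) < 1.
Proof.
move=> [v0 Av] l0 v1; rewrite lt_neqAle modulus_sum_sqr_le1 ?andbT//.
apply/eqP => S1; have [c c1 cS] := exists_half_phase (\sum_k v k 0 ^+ 2).
(* By [S1] the squared imaginary parts of [c v] sum to [(1 - 1) / 2]. *)
have cv_real k : complex.Im (c * v k 0) = 0.
  apply/eqP; rewrite -sqrf_eq0; apply/eqP; move: k.
  have := sum_sqr_Im (fun k => v k 0) c1; rewrite v1 cS S1 subrr mul0r.
  by move=> /psumr_eq0P h k; apply: h => // i _; exact: sqr_ge0.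
pose x := re_mx (c *: v).
have xE : toC x = c *: v.
  apply/colP => k; rewrite !mxE; move: (cv_real k).
  by case: (c * v k 0) => a b /= ->.
have Ax : toC (A *m x) = l *: toC x.
  by rewrite map_mxM /= xE -scalemxAr Av !scalerA mulrC.
have x0 : x = 0.
  apply/colP => k; rewrite [RHS]mxE; apply/eqP.
  (* [A x] is real, whereas entry [k] of [l x] has imaginary part [Im l * x_k]. *)
  have /(congr1 (@complex.Im R)) := congr1 (fun B : 'cV_n => B k 0) Ax.
  rewrite [X in complex.Im X = _]mxE /= [X in complex.Im X]mxE [toC x k 0]mxE.
  by rewrite mulrC Im_realM => /esym/eqP; rewrite mulf_eq0 (negPf l0) orbF.
have /eqP := xE; rewrite x0 map_mx0 eq_sym scaler_eq0 (negPf v0) orbF.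
by rewrite -modulus_eq0 c1 oner_eq0.
Qed.

(** * Euclidean estimates for the modes *)

Section EuclideanModes.
Variables (R : realType) (n : nat) (m : mode R n).
Local Notation eu := (@euclidean_norm R n).
Hypothesis hN : is_norm eu.
Hypotheses (vec_neq0 : vec m != 0) (row_vec_neq0 : row_vec m != 0).
Hypothesis lam_nonreal : lam m \isn't Num.real.
Variables (alpha beta : 'I_n -> R) (gamma : 'cV[R]_n -> R).
Hypothesis halpha : forall k, is_angle (vhat eu m k 0) (alpha k).
Hypothesis hbeta : forall l, is_angle (what eu m 0 l) (beta l).

Let vhat1 : \sum_k modulus (vhat eu m k 0) ^+ 2 = 1.
Proof. by rewrite -sqr_euclidean (norm_vhat hN)// expr1n. Qed.

Let what1 : \sum_l modulus (what eu m 0 l) ^+ 2 = 1.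
Proof.
apply: sum_sqr_of_rownormC_eq1 => //; last exact: rownormC_what.
apply: contraNneq row_vec_neq0 => w0.
by rewrite (row_vecE hN row_vec_neq0) w0 scaler0.
Qed.

Let V_E : V_ eu m = modulus (\sum_k vhat eu m k 0 ^+ 2).
Proof.
by rewrite /V_ mxE; congr modulus; apply: eq_bigr => k _; rewrite mxE expr2.
Qed.

Let W_E : W_ eu m = modulus (\sum_l what eu m 0 l ^+ 2).
Proof.
by rewrite /W_ mxE; congr modulus; apply: eq_bigr => l _; rewrite [_^T _ _]mxE expr2.
Qed.

Let unit_phase t u : modulus (cis (omega m * t) * cis (gamma u)) = 1.
Proof. by rewrite modulusM !modulus_cis mulr1. Qed.

Lemma sqr_Theta_vec_le t u :
  eu (toC (Theta_vec eu m alpha gamma t u)) ^+ 2 <= (1 + V_ eu m) / 2.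
Proof. by rewrite Theta_vecE// V_E sqr_euclidean_re_le. Qed.

Lemma sqr_Theta_vec_ge t u :
  (1 - V_ eu m) / 2 <= eu (toC (Theta_vec eu m alpha gamma t u)) ^+ 2.
Proof. by rewrite Theta_vecE// V_E sqr_euclidean_re_ge. Qed.

Let vhat_index : exists k : 'I_n, true.
Proof. by have /cV0Pn[k _] := vec_neq0; exists k. Qed.

Lemma sqr_Theta_mx_le t :
  opnorm eu (Theta_mx eu m alpha beta t) ^+ 2 <=
  (1 + V_ eu m) * (1 + W_ eu m) / 4.
Proof.
have [k _] := vhat_index.
by rewrite Theta_mxE// V_E W_E sqr_opnorm_euclidean_le// modulus_cis.
Qed.

Lemma sqr_Theta_mx_ge t :
  a_ (V_ eu m) (W_ eu m) / 4 <= opnorm eu (Theta_mx eu m alpha beta t) ^+ 2.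
Proof. by rewrite Theta_mxE// V_E W_E sqr_opnorm_euclidean_ge// modulus_cis. Qed.

Lemma V_lt1 (A : 'M[R]_n) : is_eigenvector A (lam m) (vec m) -> V_ eu m < 1.
Proof.
move=> [_ Av]; rewrite V_E.
apply: (modulus_sum_sqr_eigenvector (A := A) (l := lam m)) => //.
  split; last by rewrite -scalemxAr Av !scalerA mulrC.
  by rewrite -(norm_eq0 hN) (norm_vhat hN)// oner_eq0.
by move: lam_nonreal; case: (lam m) => a b; rewrite complex_real.
Qed.

(* If [V_ > W_], then [W_ < V_ < 1]. *)
Lemma a_gt0 (A : 'M[R]_n) : is_eigenvector A (lam m) (vec m) ->
  0 < a_ (V_ eu m) (W_ eu m).
Proof.
move=> /V_lt1 V1; have V0 : 0 <= V_ eu m := modulus_ge0 _.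
have W0 : 0 <= W_ eu m := modulus_ge0 _.
rewrite /a_; case: ifPn => [VW|]; first by apply: mulr_gt0; lra.
by rewrite -ltNge => VW; apply: mulr_gt0; lra.
Qed.

End EuclideanModes.

(** * From the estimates to the ratios *)

Lemma mode_neq0 (R : realType) n (A : 'M[R]_n) (V : 'M[R[i]]_n) (m : mode R n) :
  V \in unitmx -> is_mode_of A V m ->
  [/\ vec m != 0, row_vec m != 0 & is_eigenvector A (lam m) (vec m)].
Proof.
move=> Vu [k [vE wE ev]]; rewrite vE; split => //; first by case: ev.
(* A zero row of the inverse would give a zero row of the identity matrix. *)
apply/eqP => w0; have : row k (invmx V *m V) = 0 by rewrite row_mul -wE w0 mul0mx.
rewrite mulVmx// => /rowP/(_ k); rewrite !mxE eqxx => /eqP.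
by rewrite oner_eq0.
Qed.

(** The common factor [s] is the 1/2 or 1/4 of the quadratic estimates; it cancels in the
    quotient. *)
Lemma ratio_le_sqrt (R : realType) (s x y a b : R) :
  0 < s -> 0 <= x -> 0 <= y -> 0 < b ->
  x ^+ 2 <= a * s -> b * s <= y ^+ 2 -> x / y <= Num.sqrt (a / b).
Proof.
move=> s0 x0 y0 b0 xa by_.
have bs0 : 0 < b * s by rewrite mulr_gt0.
have y20 : 0 < y ^+ 2 by exact: lt_le_trans by_.
rewrite -(ger0_norm (divr_ge0 x0 y0)) -sqrtr_sqr ler_wsqrtr//.
rewrite expr_div_n (_ : a / b = a * s / (b * s)); last first.
  by rewrite -mulf_div divff ?mulr1// gt_eqF.
apply: ler_pM => //; rewrite ?invr_ge0 ?sqr_ge0//.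
by rewrite lef_pV2 ?posrE.
Qed.

(** A supremum that exists dominates some value of the norm; otherwise [sup] has the default value
    0. *)
Lemma opnorm_ge0 (R : realType) n (N : 'cV[R[i]]_n -> R) (B : 'M[R]_n) :
  is_norm N -> 0 <= opnorm N B.
Proof.
move=> hN; rewrite /opnorm.
set E := (X in sup X).
have [[[x Ex] ubE]|nE] := pselect (has_sup E); last by rewrite sup_out.
by apply: le_trans (ub_le_sup ubE Ex); case: Ex => u _ <-; exact: norm_nonneg.
Qed.

Theorem theorem26 (R : realType) (n q : nat)
  (N : 'cV[R[i]]_n -> R) (hN : is_norm N)
  (A : 'M[R]_n) (r : 'I_q.+1 -> R) (hr : real_parts A r)
  (M : 'I_q.+1 -> mode R n)
  (hsimple : forall j,
     simple_real A (r j) (lam (M j)) \/ simple_complex A (r j) (lam (M j)))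
  (V : 'M[R[i]]_n) (hV : V \in unitmx)
  (hVcol : forall k, exists z, is_eigenvector A z (col k V))
  (hM : forall j, is_mode_of A V (M j))
  (hreal : forall j, simple_real A (r j) (lam (M j)) ->
     vec (M j) \is a mxOver Num.real /\ row_vec (M j) \is a mxOver Num.real)
  (hconj : forall j k, simple_complex A (r j) (lam (M j)) ->
     is_eigenvector A (Num.conj (lam (M j))) (col k V) ->
     col k V = conj_mx (vec (M j)) /\ row k (invmx V) = conj_mx (row_vec (M j)))
  (alpha beta : 'I_q.+1 -> 'I_n -> R) (gamma : 'I_q.+1 -> 'cV[R]_n -> R)
  (halpha : forall j k, simple_complex A (r j) (lam (M j)) ->
     is_angle (vhat N (M j) k 0) (alpha j k))
  (hbeta : forall j l, simple_complex A (r j) (lam (M j)) ->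
     is_angle (what N (M j) 0 l) (beta j l))
  (hgamma : forall j u, simple_complex A (r j) (lam (M j)) ->
     is_angle (what_app N (M j) u) (gamma j u))
  (gu : 'I_q.+1 -> R -> 'cV[R]_n -> R) (g : 'I_q.+1 -> R -> R)
  (hgu : forall j t (u : 'cV[R]_n),
     N (toC (Q_ (M j) t *m u)) =
     f_ N (M j) * modulus (what_app N (M j) u) * gu j t u)
  (hgu0_real : forall j t u, simple_real A (r j) (lam (M j)) ->
     what_app N (M j) u = 0 -> gu j t u = 1)
  (hgu0_complex : forall j t u, simple_complex A (r j) (lam (M j)) ->
     what_app N (M j) u = 0 ->
     gu j t u = 2 * N (toC (Theta_vec N (M j) (alpha j) (gamma j) t u)))
  (hg : forall j t, opnorm N (Q_ (M j) t) = f_ N (M j) * g j t)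
  (j : 'I_q.+1) (hj : (0 < j)%N) (t : R) (u : 'cV[R]_n)
  (hu : what_app N (M ord0) u != 0) :
  let Gu := gu j t u / gu ord0 t u in
  let G := g j t / g ord0 t in
  let normTu i := N (toC (Theta_vec N (M i) (alpha i) (gamma i) t u)) in
  let normT i := opnorm N (Theta_mx N (M i) (alpha i) (beta i) t) in
  let is_real i := simple_real A (r i) (lam (M i)) in
  let is_complex i := simple_complex A (r i) (lam (M i)) in
  let Vj := V_ N (M j) in
  let Wj := W_ N (M j) in
  let V1 := V_ N (M ord0) in
  let W1 := W_ N (M ord0) in
  [/\ is_real j -> is_real ord0 -> Gu = 1 /\ G = 1,

      is_complex j -> is_real ord0 ->
        [/\ Gu = 2 * normTu j,
            G = 2 * normT j
          & forall p : \bar R, (1 <= p)%E -> N =1 pnorm p ->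
              Gu <= 2 /\ G <= 2],

      is_real j -> is_complex ord0 ->
        [/\ Gu = 1 / (2 * normTu ord0),
            G = 1 / (2 * normT ord0)
          & N =1 @euclidean_norm R n ->
              Gu <= Num.sqrt (1 / (2 * (1 - V1))) /\
              G <= Num.sqrt (1 / a_ V1 W1)]
    & is_complex j -> is_complex ord0 ->
        [/\ Gu = normTu j / normTu ord0,
            G = normT j / normT ord0
          & N =1 @euclidean_norm R n ->
              Gu <= Num.sqrt ((1 + Vj) / (1 - V1)) /\
              G <= Num.sqrt ((1 + Vj) * (1 + Wj) / a_ V1 W1)]].
Proof.
have modeP i := mode_neq0 hV (hM i).
have f0 i : f_ N (M i) != 0 by have [v0 w0 _] := modeP i; rewrite gt_eqF ?f_gt0.
have nonreal i : simple_complex A (r i) (lam (M i)) -> lam (M i) \isn't Num.real.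
  move=> [_ im0 _ _]; move: im0; case: (lam (M i)) => a b /= b0.
  by rewrite complex_real gt_eqF.
(* Where [what u] is nonzero, the factor [f |what u|] cancels in [hgu]; elsewhere the value is the
   convention [hgu0_real]. *)
have gu_real i t' u' : simple_real A (r i) (lam (M i)) -> gu i t' u' = 1.
  move=> si; have [v0 w0 _] := modeP i; have [vr wr] := hreal i si.
  have [wu0|wu0] := eqVneq (what_app N (M i) u') 0; first exact: hgu0_real.
  have li : lam (M i) \is Num.real by case: si.
  have := hgu i t' u'; rewrite (norm_Q_real hN)// -{1}[_ * modulus _]mulr1.
  by move=> /mulfI <-//; rewrite mulf_neq0// modulus_eq0.
have g_real i t' : simple_real A (r i) (lam (M i)) -> g i t' = 1.
  move=> si; have [v0 w0 _] := modeP i; have [vr wr] := hreal i si.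
  have li : lam (M i) \is Num.real by case: si.
  have := hg i t'; rewrite (opnorm_Q_real hN)// -{1}[f_ _ _]mulr1.
  by move=> /mulfI <-.
have gu_complex i t' u' : simple_complex A (r i) (lam (M i)) ->
    gu i t' u' = 2 * N (toC (Theta_vec N (M i) (alpha i) (gamma i) t' u')).
  move=> si; have [v0 w0 _] := modeP i.
  have [wu0|wu0] := eqVneq (what_app N (M i) u') 0; first exact: hgu0_complex.
  have := hgu i t' u'.
  rewrite (Q_complex_mulE hN v0 w0 (nonreal i si) (fun k => halpha i k si)
    (fun l => hbeta i l si) _ (hgamma i u' si)).
  rewrite map_mxZ (norm_real hN) ger0_norm; last first.
    by rewrite mulr_ge0 ?modulus_ge0// mulr_ge0// ltW// f_gt0.
  rewrite -[2 * _ * _]mulrA mulrAC mulrC.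
  by move=> /mulfI <-//; rewrite mulf_neq0// modulus_eq0.
have g_complex i t' : simple_complex A (r i) (lam (M i)) ->
    g i t' = 2 * opnorm N (Theta_mx N (M i) (alpha i) (beta i) t').
  move=> si; have [v0 w0 _] := modeP i.
  have := hg i t'.
  rewrite (Q_complexE hN v0 w0 (nonreal i si) (fun k => halpha i k si)
    (fun l => hbeta i l si)).
  have f2 : 0 < 2 * f_ N (M i) by rewrite mulr_gt0// f_gt0.
  rewrite (opnormZ hN _ f2) -mulrA mulrCA.
  by move=> /mulfI <-.
have [v0 w0 ev0] := modeP ord0; have [vj wj evj] := modeP j.
move=> Gu G normTu normT is_real is_complex Vj Wj V1 W1.
have normTu_ge0 i : 0 <= normTu i by exact: norm_nonneg.
have normT_ge0 i : 0 <= normT i by exact: opnorm_ge0.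
have bounds i : N =1 @euclidean_norm R n -> is_complex i ->
    [/\ V_ N (M i) < 1 /\ 0 < a_ (V_ N (M i)) (W_ N (M i)),
        (1 - V_ N (M i)) / 2 <= normTu i ^+ 2 /\
          normTu i ^+ 2 <= (1 + V_ N (M i)) / 2
      & a_ (V_ N (M i)) (W_ N (M i)) / 4 <= normT i ^+ 2 /\
          normT i ^+ 2 <= (1 + V_ N (M i)) * (1 + W_ N (M i)) / 4].
  move=> NE ci; have {}NE : N = @euclidean_norm R n by apply/funext.
  have [vi wi evi] := modeP i; have li := nonreal i ci.
  have hal k := halpha i k ci; have hbe l := hbeta i l ci.
  rewrite /normTu /normT; clear - NE hN vi wi evi li hal hbe; subst N.
  split; split.
  - exact: V_lt1 evi.
  - exact: a_gt0 evi.
  - exact: sqr_Theta_vec_ge.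
  - exact: sqr_Theta_vec_le.
  - exact: sqr_Theta_mx_ge.
  - exact: sqr_Theta_mx_le.
split.
- move=> rj r0; rewrite /Gu /G (gu_real _ _ _ rj) (gu_real _ _ _ r0).
  by rewrite (g_real _ _ rj) (g_real _ _ r0) divr1.
- move=> cj r0; rewrite /Gu /G (gu_real _ _ _ r0) (g_real _ _ r0) !divr1.
  rewrite (gu_complex _ _ _ cj) (g_complex _ _ cj); split => // p p1 Np.
  have mono : forall x y : 'cV[R[i]]_n,
      (forall k, modulus (x k 0) <= modulus (y k 0)) -> N x <= N y.
    by move=> x y xy; rewrite !Np; exact: pnorm_le.
  split; rewrite ger_pMr//.
    rewrite (Theta_vecE _ (fun k => halpha j k cj)) norm_re_vhat_le1//.
    by rewrite modulusM !modulus_cis mulr1.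
  have /cV0Pn[k _] := vj.
  rewrite (Theta_mxE (fun k => halpha j k cj) (fun l => hbeta j l cj)).
  rewrite opnorm_re_le1//.
  + exact: nonreal.
  + by rewrite modulus_cis.
- move=> rj c0; rewrite /Gu /G (gu_real _ _ _ rj) (g_real _ _ rj).
  rewrite (gu_complex _ _ _ c0) (g_complex _ _ c0); split => // NE.
  have [[V1_lt1 a_pos] [Tu_ge _] [T_ge _]] := bounds ord0 NE c0.
  rewrite -/V1 -/W1 in V1_lt1 a_pos Tu_ge T_ge.
  rewrite -/(normTu ord0) -/(normT ord0).
  (* The quotients are read as [2^-1 / normTu ord0] and [2^-1 / normT ord0]. With [s = 1/4], the
     denominators [2 * (1 - V1)] and [a_ V1 W1] match the lower bounds [(1 - V1) / 2] and
     [a_ V1 W1 / 4]. *)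
  have x2 : 2^-1 ^+ 2 <= 1 * 4^-1 :> R by lra.
  split; rewrite mul1r invfM; apply: (@ratio_le_sqrt _ 4^-1) => //.
  + by apply: mulr_gt0 => //; rewrite subr_gt0.
  + by apply: le_trans Tu_ge; lra.
- move=> cj c0; rewrite /Gu /G (gu_complex _ _ _ cj) (g_complex _ _ cj).
  rewrite (gu_complex _ _ _ c0) (g_complex _ _ c0) -!mulf_div divff// !mul1r.
  split => // NE.
  have [[V1_lt1 a_pos] [Tu_ge _] [T_ge _]] := bounds ord0 NE c0.
  have [_ [_ Tu_le] [_ T_le]] := bounds j NE cj.
  rewrite -/V1 -/W1 in V1_lt1 a_pos Tu_ge T_ge.
  have V1c : 0 < 1 - V1 by rewrite subr_gt0.
  (* The vector estimates carry the factor 1/2, the matrix estimates 1/4. *)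
  split; [apply: (@ratio_le_sqrt _ 2^-1)|apply: (@ratio_le_sqrt _ 4^-1)] => //;
    by [exact: norm_nonneg | exact: opnorm_ge0].
Qed.
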